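(* Let $A$ be any unital associative algebra in any symmetric tensor category $\mathcal{C}$ over a field of characteristic zero. Then for all integers $j,k\ge 1$ such that $j$ or $k$ is odd, $$M_jM_k\subset M_{j+k-1}.$$
   Context: A symmetric tensor category is a $k$-linear abelian symmetric monoidal category with exact bilinear tensor product, over a field of characteristic zero (e.g. vector spaces or super vector spaces). With symmetry $\sigma$ and multiplication $m$ of $A$, the commutator is $[\cdot,\cdot]=m\circ(\mathrm{id}-\sigma_{A,A})$. For subobjects $X,Y\subset A$, $[X,Y]$ and $XY$ are the images of $X\otimes Y$ under the commutator and the multiplication, respectively. The lower central series is $L_1=A$, $L_{i+1}=[A,L_i]$ for $i\ge1$, and $M_i:=AL_i$ is the two-sided associative ideal of $A$ generated by $L_i$. *)

(* Defs.v *)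
From mathcomp Require Import all_boot all_algebra.
From mathcomp Require Import boolp.

Set Implicit Arguments.
Unset Strict Implicit.
Unset Printing Implicit Defensive.

Import GRing.Theory.
Local Open Scope ring_scope.

Declare Scope cat_scope.
Delimit Scope cat_scope with cat.
Local Open Scope cat_scope.

Reserved Notation "g \oc f" (at level 40, left associativity).
Reserved Notation "X \ox Y" (at level 38, left associativity).
Reserved Notation "f \tm g" (at level 38, left associativity).

(** * k-linear abelian categories *)

Record linCat (K : fieldType) := LinCat {
  obj :> Type;
  mor : obj -> obj -> lmodType K;
  idm : forall X, mor X X;
  compm : forall X Y Z, mor Y Z -> mor X Y -> mor X Z
    where "g \oc f" := (compm g f);
  comp1m : forall X Y (f : mor X Y), idm Y \oc f = f;
  compm1 : forall X Y (f : mor X Y), f \oc idm X = f;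
  compmA : forall W X Y Z (h : mor Y Z) (g : mor X Y) (f : mor W X),
    h \oc (g \oc f) = (h \oc g) \oc f;
  compm_linearl : forall X Y Z (f : mor X Y),
    linear (fun g : mor Y Z => g \oc f);
  compm_linearr : forall X Y Z (g : mor Y Z),
    linear (fun f : mor X Y => g \oc f)
}.

Arguments mor {K l} X Y.
Arguments idm {K l} X.
Arguments compm {K l X Y Z} g f.
Notation "g \oc f" := (compm g f) : cat_scope.

Section Abelian.
Variables (K : fieldType) (C : linCat K).
Implicit Types X Y Z W N Q B : C.

Definition is_iso X Y (f : mor X Y) : Prop :=
  exists g : mor Y X, g \oc f = idm X /\ f \oc g = idm Y.

Definition is_mono X Y (f : mor X Y) : Prop :=
  forall W (g h : mor W X), f \oc g = f \oc h -> g = h.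

Definition is_epi X Y (f : mor X Y) : Prop :=
  forall W (g h : mor Y W), g \oc f = h \oc f -> g = h.

Definition is_kernel N X Y (i : mor N X) (f : mor X Y) : Prop :=
  f \oc i = 0 /\
  forall W (g : mor W X), f \oc g = 0 -> exists! h : mor W N, i \oc h = g.

Definition is_cokernel X Y Q (p : mor Y Q) (f : mor X Y) : Prop :=
  p \oc f = 0 /\
  forall W (g : mor Y W), g \oc f = 0 -> exists! h : mor Q W, h \oc p = g.

(* 0 -> N -> X -> Q -> 0 *)
Definition short_exact N X Q (i : mor N X) (p : mor X Q) : Prop :=
  is_kernel i p /\ is_cokernel p i.

Definition is_zero_object Z : Prop :=
  (forall X (f : mor X Z), f = 0) /\ (forall X (f : mor Z X), f = 0).

Definition is_biproduct X Y B
    (i1 : mor X B) (i2 : mor Y B) (p1 : mor B X) (p2 : mor B Y) : Prop :=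
  [/\ p1 \oc i1 = idm X, p2 \oc i2 = idm Y, p2 \oc i1 = 0, p1 \oc i2 = 0
    & i1 \oc p1 + i2 \oc p2 = idm B].

Record is_abelian : Prop := IsAbelian {
  has_zero_object : exists Z, is_zero_object Z;
  has_biproducts : forall X Y, exists B
    (i1 : mor X B) (i2 : mor Y B) (p1 : mor B X) (p2 : mor B Y),
    is_biproduct i1 i2 p1 p2;
  has_kernels : forall X Y (f : mor X Y),
    exists N (i : mor N X), is_kernel i f;
  has_cokernels : forall X Y (f : mor X Y),
    exists Q (p : mor Y Q), is_cokernel p f;
  mono_normal : forall X Y (f : mor X Y), is_mono f ->
    exists Z (g : mor Y Z), is_kernel f g;
  epi_normal : forall X Y (f : mor X Y), is_epi f ->
    exists Z (g : mor Z X), is_cokernel f g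
}.

Lemma kernel_mono N X Y (i : mor N X) (f : mor X Y) :
  is_kernel i f -> is_mono i.
Proof.
move=> [fi0 uni] W g h igh.
have [|k [_ kU]] := uni W (i \oc g).
  rewrite compmA fi0.
  have := compm_linearl g (-1) 0 (0 : mor N Y).
  by rewrite scaler0 addr0 scaleN1r addNr.
by rewrite -(kU g) // -(kU h).
Qed.

End Abelian.

(** * Symmetric tensor categories *)

Record symTensorCat (K : fieldType) := SymTensorCat {
  stc_cat :> linCat K;
  stc_abelian : is_abelian stc_cat;

  tens : stc_cat -> stc_cat -> stc_cat
    where "X \ox Y" := (tens X Y);
  tensm : forall X X' Y Y' : stc_cat,
    mor X X' -> mor Y Y' -> mor (X \ox Y) (X' \ox Y')
    where "f \tm g" := (tensm f g);
  tensm1 : forall X Y, idm X \tm idm Y = idm (X \ox Y);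
  tensmM : forall X X' X'' Y Y' Y'' (f' : mor X' X'') (f : mor X X')
      (g' : mor Y' Y'') (g : mor Y Y'),
    (f' \oc f) \tm (g' \oc g) = (f' \tm g') \oc (f \tm g);
  tensm_linearl : forall X X' Y Y' (g : mor Y Y'),
    linear (fun f : mor X X' => f \tm g);
  tensm_linearr : forall X X' Y Y' (f : mor X X'),
    linear (fun g : mor Y Y' => f \tm g);
  tensm_exactl : forall X N Y Q (i : mor N Y) (p : mor Y Q),
    short_exact i p -> short_exact (idm X \tm i) (idm X \tm p);
  tensm_exactr : forall X N Y Q (i : mor N Y) (p : mor Y Q),
    short_exact i p -> short_exact (i \tm idm X) (p \tm idm X);

  tunit : stc_cat;
  assoc : forall X Y Z, mor ((X \ox Y) \ox Z) (X \ox (Y \ox Z));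
  lunit : forall X, mor (tunit \ox X) X;
  runit : forall X, mor (X \ox tunit) X;
  assoc_iso : forall X Y Z, is_iso (assoc X Y Z);
  lunit_iso : forall X, is_iso (lunit X);
  runit_iso : forall X, is_iso (runit X);
  assoc_nat : forall X X' Y Y' Z Z'
      (f : mor X X') (g : mor Y Y') (h : mor Z Z'),
    assoc X' Y' Z' \oc ((f \tm g) \tm h)
    = (f \tm (g \tm h)) \oc assoc X Y Z;
  lunit_nat : forall X X' (f : mor X X'),
    lunit X' \oc (idm tunit \tm f) = f \oc lunit X;
  runit_nat : forall X X' (f : mor X X'),
    runit X' \oc (f \tm idm tunit) = f \oc runit X;
  pentagon : forall W X Y Z,
    assoc W X (Y \ox Z) \oc assoc (W \ox X) Y Z
    = (idm W \tm assoc X Y Z) \oc assoc W (X \ox Y) Z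
        \oc (assoc W X Y \tm idm Z);
  triangle : forall X Y,
    (idm X \tm lunit Y) \oc assoc X tunit Y = runit X \tm idm Y;

  symm : forall X Y, mor (X \ox Y) (Y \ox X);
  symm_nat : forall X X' Y Y' (f : mor X X') (g : mor Y Y'),
    symm X' Y' \oc (f \tm g) = (g \tm f) \oc symm X Y;
  symmK : forall X Y, symm Y X \oc symm X Y = idm (X \ox Y);
  hexagon : forall X Y Z,
    assoc Y Z X \oc symm X (Y \ox Z) \oc assoc X Y Z
    = (idm Y \tm symm X Z) \oc assoc Y X Z \oc (symm X Y \tm idm Z)
}.

Arguments tens {K s} X Y.
Arguments tensm {K s X X' Y Y'} f g.
Arguments tunit {K s}.
Arguments assoc {K s} X Y Z.
Arguments lunit {K s} X.
Arguments runit {K s} X.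
Arguments symm {K s} X Y.
Notation "X \ox Y" := (tens X Y) : cat_scope.
Notation "f \tm g" := (tensm f g) : cat_scope.

(** * Subobjects and images *)

Record subobject (K : fieldType) (C : linCat K) (X : C) := Subobject {
  sub_dom : C;
  sub_arr : mor sub_dom X;
  sub_mono : is_mono sub_arr
}.

(* Inclusion of subobjects: S factors through T. *)
Definition sub_le (K : fieldType) (C : linCat K) (X : C)
    (S T : subobject X) : Prop :=
  exists f : mor (sub_dom S) (sub_dom T), sub_arr T \oc f = sub_arr S.

Section Images.
Variables (K : fieldType) (C : symTensorCat K).
Implicit Types X Y : C.

Lemma idm_mono X : is_mono (idm X).
Proof. by move=> W g h; rewrite !comp1m. Qed.

Definition full_sub X : subobject X := Subobject (@idm_mono X).

(* Kernels and cokernels are picked by choice; they are unique up to unique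
   isomorphism. *)
Definition ker_sub X Y (f : mor X Y) : subobject X :=
  let N := cid (has_kernels (stc_abelian C) f) in
  let i := cid (projT2 N) in
  Subobject (kernel_mono (projT2 i)).

Definition coker_obj X Y (f : mor X Y) : C :=
  projT1 (cid (has_cokernels (stc_abelian C) f)).

Definition coker X Y (f : mor X Y) : mor Y (coker_obj f) :=
  projT1 (cid (projT2 (cid (has_cokernels (stc_abelian C) f)))).

Lemma cokerP X Y (f : mor X Y) : is_cokernel (coker f) f.
Proof. exact: (projT2 (cid (projT2 (cid (has_cokernels (stc_abelian C) f))))). Qed.

Lemma ker_subP X Y (f : mor X Y) : is_kernel (sub_arr (ker_sub f)) f.
Proof. exact: (projT2 (cid (projT2 (cid (has_kernels (stc_abelian C) f))))). Qed.

Definition im_sub X Y (f : mor X Y) : subobject Y := ker_sub (coker f).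

End Images.

(** * Algebras and the lower central series *)

Record algebraIn (K : fieldType) (C : symTensorCat K) := AlgebraIn {
  carrier :> C;
  amul : mor (carrier \ox carrier) carrier;
  aunit : mor tunit carrier;
  amulA : amul \oc (amul \tm idm carrier)
          = amul \oc (idm carrier \tm amul) \oc assoc carrier carrier carrier;
  amul1m : amul \oc (aunit \tm idm carrier) = lunit carrier;
  amulm1 : amul \oc (idm carrier \tm aunit) = runit carrier
}.

Section LowerCentralSeries.
Variables (K : fieldType) (C : symTensorCat K) (A : algebraIn C).
Implicit Types S T : subobject (carrier A).

Definition commutator : mor (A \ox A) A :=
  amul A \oc (idm (A \ox A) - symm A A).

Definition sub_comm S T : subobject (carrier A) :=
  im_sub (commutator \oc (sub_arr S \tm sub_arr T)).

Definition sub_mul S T : subobject (carrier A) :=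
  im_sub (amul A \oc (sub_arr S \tm sub_arr T)).

(* Indexed from 1; [lcs 0] is a dummy value, equal to [lcs 1]. *)
Definition lcs (i : nat) : subobject (carrier A) :=
  iter i.-1 (sub_comm (full_sub A)) (full_sub A).

Definition lcs_ideal (i : nat) : subobject (carrier A) :=
  sub_mul (full_sub A) (lcs i).

End LowerCentralSeries.

(* Main.v *)
From Stdlib Require Import Ncring Ncring_tac.
From HB Require Import structures.
Require Import Defs.
From mathcomp Require Import all_boot all_algebra.
From mathcomp Require Import boolp zify.

(* In an associative ring containing 1/6, with lower central series [L_n], if [p]
   and [q] are odd then [ab, c] lies in [L_(p+q)] for all [a] in [L_p], [b] in [L_q]
   and all [c].  This goes by induction on [p + q], using the cyclic identity
   [ab, c] + [bc, a] + [ca, b] = 0 when [p, q >= 3], and a symmetry argument that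
   ends with [3 h = 0] when [p = 1].  So [M_j, L_s] is contained in [L_(j+s)] for
   [j] odd, and m [c, w] = [m c, w] - [m, w] c then gives M_j M_k in M_(j+k-1).

   The passage to a symmetric tensor category uses actual rings: if [B] is a
   cocommutative coalgebra, Hom(B, A) is an associative ring under convolution.
   Tensoring [B] with coalgebras [1 (+) X], [X] primitive, adjoins free variables
   ranging over [X], and subobjects of [A] such as [L_n] are images of the
   multilinear parts of elements of such rings. *)

Set Implicit Arguments.
Unset Strict Implicit.
Unset Printing Implicit Defensive.

Import GRing.Theory.
Local Open Scope ring_scope.
Local Open Scope cat_scope.

(** * Products of odd terms of the lower central series of a ring *)

Section NoncommutativeRing.
Variable R : pzRingType.

(** Makes [R] available to [non_commutative_ring], which checks the commutator identities below. *)
#[local] Instance ncring_ops : @Ring_ops R 0 1 +%R *%R (fun x y => x - y) -%R eq := {}.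
#[local] Instance ncring : Ring (Ro := ncring_ops).
Proof.
constructor; rewrite /equality /eq_notation /addition /add_notation
  /multiplication /mul_notation /opposite /opp_notation /zero /zero_notation
  /one /one_notation /subtraction /sub_notation; try by move=> ? ? -> ? ? ->.
- exact: eq_equivalence.
- by move=> ? ? ->.
- exact: add0r.
- exact: addrC.
- exact: addrA.
- exact: mul1r.
- exact: mulr1.
- exact: mulrA.
- exact: mulrDl.
- by move=> x y z; exact: mulrDr.
- by [].
- exact: subrr.
Qed.

(** * Lower central series of a ring *)

Definition brk (x y : R) : R := x * y - y * x.

Ltac brk_ring := rewrite /brk; non_commutative_ring.

(** Closure under sums is enough to get additive subgroups: a sign or a central scalar is absorbed
    by the entry [r]. [lc 0] is empty. *)
Inductive lc : nat -> R -> Prop :=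
| lc_one x : lc 1 x
| lc_brk n r x : lc n x -> lc n.+1 (brk r x)
| lc_add n x y : lc n x -> lc n y -> lc n (x + y).

Lemma lc_gt0 n x : lc n x -> (0 < n)%N.
Proof. by elim. Qed.

Lemma lc_ind_brk (P : R -> Prop) n : (0 < n)%N ->
    (forall x y, P x -> P y -> P (x + y)) ->
    (forall r x, lc n x -> P (brk r x)) ->
  forall x, lc n.+1 x -> P x.
Proof.
move=> n0 PD Pb x; move En: n.+1 => m lx.
elim: lx En => [y | k r y ly _ [Ek] | k y z _ IHy _ IHz Ek].
- by case=> En; move: n0; rewrite En.
- by apply: Pb; rewrite Ek.
- by apply: PD; [exact: IHy | exact: IHz].
Qed.

Lemma lc_opp n x : lc n x -> lc n (- x).
Proof.
elim=> [y | k r y ly _ | k y z _ ly _ lz]; first exact: lc_one.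
- by have -> : - brk r y = brk (- r) y by [brk_ring]; exact: lc_brk.
- by rewrite opprD; exact: lc_add.
Qed.

Lemma lc_sub n x y : lc n x -> lc n y -> lc n (x - y).
Proof. by move=> lx ly; apply: lc_add => //; exact: lc_opp. Qed.

Lemma lc_brkr n x r : lc n x -> lc n.+1 (brk x r).
Proof.
move=> lx; have -> : brk x r = - brk r x by brk_ring.
by apply: lc_opp; exact: lc_brk.
Qed.

Lemma lcW n x : (0 < n)%N -> lc n.+1 x -> lc n x.
Proof.
case: n => // n _; elim: n x => [|n IHn] x lx; first exact: lc_one.
elim/lc_ind_brk: lx => // [y z|r y ly]; first exact: lc_add.
by apply: lc_brk; exact: IHn.
Qed.

(** By Jacobi, [[[r, y], x] = [r, [y, x]] - [y, [r, x]]], so each entry of a nested bracket [w]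
    raises the degree by one. The filtration [L] is abstract in order to cover both [lc] and, later,
    [lands_lcs]. *)
Lemma brk_lc_shift (L : nat -> R -> Prop) :
    (forall n x y, L n x -> L n y -> L n (x - y)) ->
    (forall n x y, L n x -> L n y -> L n (x + y)) ->
    (forall n r x, L n x -> L n.+1 (brk r x)) ->
  forall s, forall w, lc s w -> forall n x, L n x -> L (s + n)%N (brk w x).
Proof.
move=> LB LD Lb s w; elim=> [y | k r y _ IHy | k y z _ IHy _ IHz] n x Lx.
- by rewrite add1n; exact: Lb.
- have -> : brk (brk r y) x = brk r (brk y x) - brk y (brk r x) by brk_ring.
  apply: LB; first by rewrite addSn; apply: Lb; exact: IHy.
  by rewrite addSnnS; apply: IHy; exact: Lb.
- have -> : brk (y + z) x = brk y x + brk z x by brk_ring.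
  by apply: LD; [exact: IHy | exact: IHz].
Qed.

Lemma brk_lc m n x y : lc m x -> lc n y -> lc (m + n) (brk x y).
Proof.
move=> lx; apply: (brk_lc_shift lc_sub lc_add _ lx).
by move=> *; exact: lc_brk.
Qed.

(** The same Jacobi induction for an [x] that is known only through its brackets with [R]. *)
Lemma brk_shift (L : nat -> R -> Prop) n x :
    (forall n x y, L n x -> L n y -> L n (x - y)) ->
    (forall n x y, L n x -> L n y -> L n (x + y)) ->
    (forall n r x, L n x -> L n.+1 (brk r x)) ->
    (forall r, L n.+1 (brk r x)) ->
  forall s w, lc s w -> L (s + n)%N (brk w x).
Proof.
move=> LB LD Lb Lx s w; elim=> [y | k r y ly IHy | k y z _ IHy _ IHz].
- exact: Lx.
- have -> : brk (brk r y) x = brk r (brk y x) - brk y (brk r x) by brk_ring.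
  apply: (LB); first by rewrite addSn; exact: Lb.
  by rewrite addSnnS; exact: (brk_lc_shift LB LD Lb ly).
- have -> : brk (y + z) x = brk y x + brk z x by brk_ring.
  exact: LD.
Qed.

(** For [n > 0], the preimage of the centre of the Lie ring [R / L_n]. *)
Definition lc_center n x := forall r, lc n (brk r x).

Lemma lc_centerD n x y : lc_center n x -> lc_center n y -> lc_center n (x + y).
Proof.
move=> Vx Vy r; have -> : brk r (x + y) = brk r x + brk r y by brk_ring.
exact: lc_add.
Qed.

Lemma lc_centerN n x : lc_center n x -> lc_center n (- x).
Proof.
move=> Vx r; have -> : brk r (- x) = - brk r x by brk_ring.
exact: lc_opp.
Qed.

Lemma lc_centerB n x y : lc_center n x -> lc_center n y -> lc_center n (x - y).
Proof. by move=> Vx Vy; apply: lc_centerD => //; exact: lc_centerN. Qed.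

Lemma lc_center_lc n x : lc n x -> lc_center n.+1 x.
Proof. by move=> lx r; exact: lc_brk. Qed.

Lemma lc_center_brk n x s w : lc_center n.+1 x -> lc s w -> lc (s + n) (brk w x).
Proof.
move=> Vx; apply: (brk_shift lc_sub lc_add) => //.
by move=> *; exact: lc_brk.
Qed.

(** * Division by 2 and 3 *)

Variable inv6 : R.
Hypothesis inv6P : inv6 *+ 6 = 1.

Lemma inv6C x : inv6 * x = x * inv6.
Proof.
have <- : inv6 * x * (inv6 *+ 6) = inv6 * x by rewrite inv6P mulr1.
have <- : inv6 *+ 6 * x * inv6 = x * inv6 by rewrite inv6P mul1r.
by rewrite mulrnAr !mulrnAl.
Qed.

Lemma lc_mul_inv6 n x : lc n x -> lc n (inv6 * x).
Proof.
elim=> [y | k r y ly _ | k y z _ ly _ lz]; first exact: lc_one.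
- have -> : inv6 * brk r y = brk (inv6 * r) y.
    by rewrite /brk mulrBr !mulrA (inv6C y) -!mulrA (inv6C r).
  exact: lc_brk.
- by rewrite mulrDr; exact: lc_add.
Qed.

Lemma lc_div6 n x : lc n (x *+ 6) -> lc n x.
Proof. by move/lc_mul_inv6; rewrite mulrnAr -mulrnAl inv6P mul1r. Qed.

Lemma lc_mulrn n x m : lc n x -> lc n (x *+ m.+1).
Proof. by move=> lx; elim: m => // m IH; rewrite mulrS; exact: lc_add. Qed.

Lemma lc_div2 n x : lc n (x + x) -> lc n x.
Proof.
by move=> l2; apply: lc_div6; rewrite (mulrnA x 2 3) mulr2n; exact: lc_mulrn.
Qed.

Lemma lc_div3 n x : lc n (x + x + x) -> lc n x.
Proof.
move=> l3; apply: lc_div6; rewrite (mulrnA x 3 2) (mulrSr x 2) (mulr2n x).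
exact: lc_mulrn.
Qed.

(* Modulo [L_4], the function [v, b, x, y -> [v [[x, y], b], c]] has the
   symmetries of a curvature tensor, and the cyclic identity
   [[p q, c] + [q c, p] + [c p, q] = 0] makes it alternate in [v] and [c]
   too; hence it is alternating, and the Bianchi identity kills it. *)
Lemma lc_center_L1L3 v b : lc 3 b -> lc_center 4 (v * b).
Proof.
elim/lc_ind_brk => // [x y Vx Vy | b' u].
  by rewrite mulrDr; exact: lc_centerD.
elim/lc_ind_brk => // [x y|x y _].
  have -> : v * brk b' (x + y) = v * brk b' x + v * brk b' y by brk_ring.
  exact: lc_centerD.
move=> c.
pose k v b x y c : R := brk c (v * brk b (brk x y)).
rewrite -/(k v b' x y c) {u b}; move: v b' x y c.
have kvb v b x y c : lc 4 (k v b x y c + k b v x y c).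
  have -> : k v b x y c + k b v x y c =
      brk c (brk (brk (brk x y) v) b) - brk c (brk (brk x y) (v * b)).
    by rewrite /k; brk_ring.
  have l2 : lc 2 (brk x y) by apply: lc_brk; exact: lc_one.
  apply: lc_sub; apply: lc_brk; last exact: (brk_lc l2 (lc_one (v * b))).
  by do 2!apply: lc_brkr; exact: lc_one.
have kvc v b x y c : lc 4 (k v b x y c + k c b x y v).
  set l := brk b (brk x y).
  have l3 : lc 3 l by do 2!apply: lc_brk; exact: lc_one.
  have -> : k v b x y c + k c b x y v = brk (c * v) l - brk v (brk l c).
    by rewrite /k -/l; brk_ring.
  apply: lc_sub; first exact: lc_brk.
  by apply: lcW => //; apply: lc_brk; exact: lc_brkr.
(* The standard derivation of pair symmetry for a curvature tensor: antisymmetry in [x], [y] and the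
   Bianchi identity in [b], [x], [y] hold exactly, the latter by Jacobi, and [kvb] gives
   antisymmetry in [v], [b]. *)
have pair v b x y c : lc 4 (k v b x y c - k x y v b c).
  apply: lc_div2.
  have -> : k v b x y c - k x y v b c + (k v b x y c - k x y v b c) =
      (k b y v x c + k y b v x c) + (k v b x y c + k b v x y c)
      + (k x v b y c + k v x b y c) + (k x b y v c + k b x y v c)
      - (k y v b x c + k v y b x c) - (k x y v b c + k y x v b c).
    by rewrite /k; brk_ring.
  by do ![exact: kvb | apply: lc_sub | apply: lc_add].
have kxc v b x y c : lc 4 (k v b x y c + k v b c y x).
  have -> : k v b x y c + k v b c y x = (k v b x y c - k x y v b c)
      + (k x y v b c + k c y v b x) + (k v b c y x - k c y v b x).
    by rewrite /k; brk_ring.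
  by do ![exact: pair | exact: kvc | apply: lc_add].
have kbc v b x y c : lc 4 (k v b x y c + k v c x y b).
  have -> : k v b x y c + k v c x y b = (k v b x y c + k b v x y c)
      - (k b v x y c + k c v x y b) + (k c v x y b + k v c x y b).
    by rewrite /k; brk_ring.
  by do ![exact: kvb | exact: kvc | apply: lc_sub | apply: lc_add].
(* A cyclic shift of [b], [x], [y] is even, so alternation preserves [k]. *)
have cyc v b x y c : lc 4 (k v b x y c - k v x y b c).
  have -> : k v b x y c - k v x y b c = (k v b x y c + k v c x y b)
      - (k v c x y b + k v c b y x) + (k v c b y x + k v x b y c).
    by rewrite /k; brk_ring.
  by do ![exact: kbc | exact: kxc | apply: lc_sub | apply: lc_add].
(* The three cyclic shifts sum to zero by Jacobi and agree modulo [L_4], whence [3 k] lies in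
   [L_4]. *)
move=> v b x y c; apply: lc_div3.
have -> : k v b x y c + k v b x y c + k v b x y c =
    (k v b x y c - k v x y b c) - (k v y b x c - k v b x y c).
  by rewrite /k; brk_ring.
exact: lc_sub.
Qed.

(* Write [h_v] for [h v x y z] up to the order of its last three arguments;
   the last hypothesis says [h_v + h_x + h_y = 0] for any three of the four. *)
Lemma sym_cyclic_vanish (P : R -> Prop) (h : R -> R -> R -> R -> R) :
    (forall x y, P x -> P y -> P (x + y)) ->
    (forall x y, P x -> P y -> P (x - y)) ->
    (forall x, P (x + x + x) -> P x) ->
    (forall v x y z, P (h v x y z - h v y x z)) ->
    (forall v x y z, P (h v x y z - h v x z y)) ->
    (forall v x y z, P (h v x y z + h x y v z + h y v x z)) ->
  forall v x y z, P (h v x y z).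
Proof.
move=> PD PB P3 hxy hyz hcyc v x y z.
have cyc_vxy : P (h v x y z + h x v y z + h y v x z).
  have -> : h v x y z + h x v y z + h y v x z =
      (h v x y z + h x y v z + h y v x z) + (h x v y z - h x y v z).
    by non_commutative_ring.
  exact: (PD).
have cyc_vxz : P (h v x y z + h x v y z + h z v x y).
  have -> : h v x y z + h x v y z + h z v x y =
      (h v x z y + h x z v y + h z v x y) + (h v x y z - h v x z y)
      + (h x v y z - h x v z y) + (h x v z y - h x z v y).
    by non_commutative_ring.
  by do ![exact: hcyc | exact: hxy | exact: hyz | apply: (PD)].
have cyc_vyz : P (h v x y z + h y v x z + h z v x y).
  have -> : h v x y z + h y v x z + h z v x y =
      (h v y z x + h y z v x + h z v y x)
      + (h v x y z - h v y x z) + (h v y x z - h v y z x)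
      + (h y v x z - h y v z x) + (h y v z x - h y z v x)
      + (h z v x y - h z v y x).
    by non_commutative_ring.
  by do ![exact: hcyc | exact: hxy | exact: hyz | apply: (PD)].
have cyc_xyz : P (h x v y z + h y v x z + h z v x y).
  have -> : h x v y z + h y v x z + h z v x y =
      (h x y z v + h y z x v + h z x y v)
      + (h x v y z - h x y v z) + (h x y v z - h x y z v)
      + (h y v x z - h y x v z) + (h y x v z - h y x z v) + (h y x z v - h y z x v)
      + (h z v x y - h z x v y) + (h z x v y - h z x y v).
    by non_commutative_ring.
  by do ![exact: hcyc | exact: hxy | exact: hyz | apply: (PD)].
(* [3 h_v] is the sum of the three relations containing [h_v] minus twice the one without it. *)
apply: P3.
have -> : h v x y z + h v x y z + h v x y z =
    (h v x y z + h x v y z + h y v x z) + (h v x y z + h x v y z + h z v x y)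
    + (h v x y z + h y v x z + h z v x y)
    - (h x v y z + h y v x z + h z v x y) - (h x v y z + h y v x z + h z v x y).
  by non_commutative_ring.
by do 2!apply: (PB) => //; do 2!apply: (PD) => //.
Qed.

(** * The induction step on [p + q] *)

Section Step.
Variable d : nat.
Hypothesis IH : forall p q a b, (p + q <= d)%N -> odd p -> odd q ->
  lc p a -> lc q b -> lc_center (p + q) (a * b).

(** The cyclic identity trades [[c, ab]] for brackets of [a] with [bc] and of [b] with [ac], up to
    [[b, [a, c]]]. As [p, q >= 3], [IH] covers the pairs [(q, 1)] and [(p, 1)], so [bc] and [ac] are
    central modulo [L_(q+1)] and [L_(p+1)]. *)
Lemma step_ge3 p q a b : (p + q)%N = d.+2 -> odd p -> odd q ->
    (3 <= p)%N -> (3 <= q)%N -> lc p a -> lc q b -> lc_center d.+2 (a * b).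
Proof.
move=> pq op oq p3 q3 la lb c.
have -> : brk c (a * b) = brk b (brk a c) - (brk a (b * c) + brk b (a * c)).
  by brk_ring.
have lba : lc d.+2 (brk a (b * c)).
  have -> : d.+2 = (p + q)%N by [].
  apply: lc_center_brk la; have := IH (p := q) (q := 1) _ oq isT lb (lc_one c).
  by rewrite addn1; apply; lia.
have lab : lc d.+2 (brk b (a * c)).
  have -> : d.+2 = (q + p)%N by rewrite addnC.
  apply: lc_center_brk lb; have := IH (p := p) (q := 1) _ op isT la (lc_one c).
  by rewrite addn1; apply; lia.
apply: lc_sub; last exact: lc_add.
have := brk_lc lb (lc_brkr c la).
by rewrite addnS addnC pq; exact: lcW.
Qed.

Hypotheses (d4 : (4 <= d)%N) (d_even : ~~ odd d).

(** By the Leibniz rule the sum is [[u, ab]], which lies in [L_(d+1)]. Hence [u] can be moved from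
    one factor to the other at the cost of a sign. *)
Lemma step_brk p q s a b u : (p + q + s)%N = d.+2 -> (0 < s)%N -> odd p -> odd q ->
    lc p a -> lc q b -> lc s u -> lc_center d.+2 (a * brk u b + brk u a * b).
Proof.
move=> pqs s0 op oq la lb lu.
have -> : a * brk u b + brk u a * b = brk u (a * b) by brk_ring.
apply: lc_center_lc; have <- : (s + (p + q).-1 = d.+1)%N by lia.
apply: lc_center_brk => //; rewrite prednK; last by have := lc_gt0 la; lia.
by apply: IH => //; lia.
Qed.

(** Moving [u] onto [v] gives [[u, v]] in [L_3] times [b] in [L_(d-1)], a case of [step_ge3]. *)
Lemma step_L2 v b u : lc d.-1 b -> lc 2 u -> lc_center d.+2 (v * brk u b).
Proof.
move=> lb lu.
have -> : v * brk u b = (v * brk u b + brk u v * b) - brk u v * b by brk_ring.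
apply: lc_centerB.
  by apply: (step_brk (p := 1) (q := d.-1) (s := 2)) => //; [lia | lia | exact: lc_one].
by apply: (step_ge3 (p := 3) (q := d.-1)) => //; [lia | lia | lia | exact: lc_brkr].
Qed.

(** Here [b] is moved instead: [[b, v]] in [L_(d-1)] times [u] in [L_3]. *)
Lemma step_L3 v b u : lc d.-2 b -> lc 3 u -> lc_center d.+2 (v * brk u b).
Proof.
move=> lb lu.
have -> : v * brk u b = brk b v * u - (v * brk b u + brk b v * u) by brk_ring.
apply: lc_centerB; last first.
  by apply: (step_brk (p := 1) (q := 3) (s := d.-2)) => //; [lia | lia | exact: lc_one].
apply: (step_ge3 (p := d.-1) (q := 3)) => //; [lia | lia | lia |].
by have -> : d.-1 = d.-2.+1 by [lia]; exact: lc_brkr.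
Qed.

Lemma step_nested v x y z b :
  lc d.-2 b -> lc_center d.+2 (v * brk x (brk y (brk z b))).
Proof.
move=> lb; pose h v x y z := v * brk x (brk y (brk z b)).
have l1 t : lc d.-1 (brk t b) by have -> : d.-1 = d.-2.+1 by [lia]; exact: lc_brk.
have l2 s t : lc 2 (brk s t) by apply: lc_brk; exact: lc_one.
apply: (@sym_cyclic_vanish (lc_center d.+2) h) => {v x y z}.
- exact: lc_centerD.
- exact: lc_centerB.
- move=> x Vx r; apply: lc_div3.
  have -> : brk r x + brk r x + brk r x = brk r (x + x + x) by brk_ring.
  exact: Vx.
- move=> v x y z.
  have -> : h v x y z - h v y x z = v * brk (brk x y) (brk z b) by rewrite /h; brk_ring.
  exact: step_L2.
- move=> v x y z.
  have -> : h v x y z - h v x z y =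
    v * brk (brk y z) (brk x b) + v * brk (brk x (brk y z)) b by rewrite /h; brk_ring.
  by apply: lc_centerD; [exact: step_L2 | apply: step_L3 => //; exact: lc_brk].
(* Leibniz applied twice to [[x, [y, v [z, b]]]] produces [h v x y z] and cross terms. In the cyclic
   sum over [v], [x], [y] the cross terms cancel in pairs, because [[x, v] = - [v, x]]. *)
- suff V v x y z : lc_center d.+2
    (h v x y z + brk x v * brk y (brk z b) + brk y v * brk x (brk z b)).
    move=> v x y z.
    have -> : h v x y z + h x y v z + h y v x z =
       (h v x y z + brk x v * brk y (brk z b) + brk y v * brk x (brk z b))
     + (h x y v z + brk y x * brk v (brk z b) + brk v x * brk y (brk z b))
     + (h y v x z + brk v y * brk x (brk z b) + brk x y * brk v (brk z b)).
      by rewrite /h; brk_ring.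
    by do 2!apply: lc_centerD => //.
  have -> : h v x y z + brk x v * brk y (brk z b) + brk y v * brk x (brk z b) =
    brk x (brk y (v * brk z b)) - brk x (brk y v) * brk z b by rewrite /h; brk_ring.
  apply: lc_centerB.
    apply: lc_center_lc; apply: lc_brk.
    have := IH (p := 1) (q := d.-1) _ isT _ (lc_one v) (l1 z).
    by have -> : (1 + d.-1)%N = d by [lia]; apply => //; lia.
  by apply: (step_ge3 (p := 3) (q := d.-1)) => //; [lia | lia | lia | exact: lc_brk].
Qed.

(** Additivity peels three brackets off [b]; [d >= 4] leaves an innermost element in [L_(d-2)] with
    positive index, as [step_nested] expects. *)
Lemma step_L1 v b : lc d.+1 b -> lc_center d.+2 (v * b).
Proof.
have VD x y : lc_center d.+2 (v * x) -> lc_center d.+2 (v * y) ->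
    lc_center d.+2 (v * (x + y)) by rewrite mulrDr; exact: lc_centerD.
have brkD x y z : brk x (y + z) = brk x y + brk x z by brk_ring.
have E1 : d = d.-1.+1 by lia.
have E2 : d.-1 = d.-2.+1 by lia.
move: b; apply: lc_ind_brk => [||x]; [lia | exact: VD |].
rewrite {1}E1; apply: lc_ind_brk => [|y z|y]; [lia | by rewrite brkD; exact: VD |].
rewrite E2; apply: lc_ind_brk => [|z t|z]; [lia | by rewrite !brkD; exact: VD |].
by move=> b'; exact: step_nested.
Qed.

End Step.

Lemma lc_center_odd_odd p q a b : odd p -> odd q -> lc p a -> lc q b ->
  lc_center (p + q) (a * b).
Proof.
have [d] := ubnP (p + q); elim: d p q a b => // d IHd p q a b le_d op oq la lb.
have swap m u w : lc m u -> lc_center m.+1 (w * u) -> lc_center m.+1 (u * w).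
  move=> lu Vwu; have -> : u * w = w * u + brk u w by brk_ring.
  by apply: lc_centerD => // r; apply: lcW => //; apply: lc_brk; exact: lc_brkr.
(* The case where one index is 1. Index 3 is the separate base case, since [step_L1] starts at
   [d = 4], that is, at index 5. *)
have main m w u : odd m -> (m < d)%N -> lc m u -> lc_center m.+1 (w * u).
  case: m => [|[|[|[|m]]]] // om lt_md lu.
  - by move=> r; apply: lc_brk; exact: lc_one.
  - exact: lc_center_L1L3.
  - apply: (@step_L1 m.+3) => //; try lia.
    by move=> p' q' a' b' le' op' oq' la' lb'; apply: IHd => //; lia.
have p0 := lc_gt0 la; have q0 := lc_gt0 lb.
have [p1 | p1] := eqVneq p 1; first by rewrite p1 add1n; apply: main => //; lia.
have [q1 | q1] := eqVneq q 1.
  by rewrite q1 addn1; apply: swap => //; apply: main => //; lia.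
have -> : (p + q = (p + q).-2.+2)%N by lia.
apply: (@step_ge3 (p + q).-2 _ p q) => //; try lia.
by move=> p' q' a' b' le' op' oq' la' lb'; apply: IHd => //; lia.
Qed.

(** * Products of an ideal with a lower central term *)

Section Ideals.
Variables L M : nat -> R -> Prop.
Hypothesis LB : forall n x y, L n x -> L n y -> L n (x - y).
Hypothesis LD : forall n x y, L n x -> L n y -> L n (x + y).
Hypothesis Lbrk : forall n r x, L n x -> L n.+1 (brk r x).
Hypothesis LM : forall n x, L n x -> M n x.
Hypothesis MB : forall n x y, M n x -> M n y -> M n (x - y).
Hypothesis MD : forall n x y, M n x -> M n y -> M n (x + y).
Hypothesis Mmull : forall n r x, M n x -> M n (r * x).
Hypothesis Mmulr : forall n r x, M n x -> M n (x * r).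

Variable j : nat.
Hypothesis Mbrk : forall r x, M j x -> L j.+1 (brk r x).

Let brk_lc_M k w x : lc k w -> M j x -> L (k + j) (brk w x).
Proof. by move=> lw Mx; apply: (brk_shift LB LD Lbrk _ lw) => r; exact: Mbrk. Qed.

(** In [x [r, y] = [y, x] r - [y, x r]] both brackets pair [y] in [L_k] with an element of the ideal
    [M_j], so they lie in [L_(k+j)] by [brk_lc_M]. *)
Lemma mul_M_lc k x w : lc k w -> M j x -> M (j + k - 1) (x * w).
Proof.
move=> lw; elim: lw x => [y | {}k r y ly _ | {}k y z _ IHy _ IHz] x Mx.
- by rewrite addnK; exact: Mmulr.
- have -> : x * brk r y = brk y x * r - brk y (x * r) by brk_ring.
  have -> : (j + k.+1 - 1 = k + j)%N by lia.
  apply: MB; last by apply: LM; apply: brk_lc_M => //; exact: Mmulr.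
  by apply: Mmulr; apply: LM; exact: brk_lc_M.
- by rewrite mulrDr; apply: MD; [exact: IHy | exact: IHz].
Qed.

Lemma mul_lc_M k x w : lc k w -> M j x -> M (j + k - 1) (w * x).
Proof.
move=> lw; elim: lw x => [y | {}k r y ly _ | {}k y z _ IHy _ IHz] x Mx.
- by rewrite addnK; exact: Mmull.
- have -> : brk r y * x = r * brk y x - brk y (r * x) by brk_ring.
  have -> : (j + k.+1 - 1 = k + j)%N by lia.
  apply: MB; last by apply: LM; apply: brk_lc_M => //; exact: Mmull.
  by apply: Mmull; apply: LM; exact: brk_lc_M.
- by rewrite mulrDl; apply: MD; [exact: IHy | exact: IHz].
Qed.

End Ideals.

End NoncommutativeRing.

(** * Abelian and symmetric tensor categories *)

Section LinearMaps.
Variables (K : fieldType) (U V : lmodType K) (f : U -> V).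
Hypothesis f_lin : linear f.

Lemma linear_add x y : f (x + y) = f x + f y.
Proof. by have := f_lin 1 x y; rewrite !scale1r. Qed.

Lemma linear_zero : f 0 = 0.
Proof. by apply: (@addrI _ (f 0)); rewrite -linear_add !addr0. Qed.

Lemma linear_opp x : f (- x) = - f x.
Proof. by apply/eqP; rewrite -addr_eq0 -linear_add addNr linear_zero. Qed.

End LinearMaps.

Section LinearCategory.
Variables (K : fieldType) (C : linCat K).
Implicit Types X Y Z W : C.

Lemma comp0m X Y Z (f : mor X Y) : (0 : mor Y Z) \oc f = 0.
Proof. exact: (linear_zero (compm_linearl f)). Qed.

Lemma compm0 X Y Z (f : mor Y Z) : f \oc (0 : mor X Y) = 0.
Proof. exact: (linear_zero (compm_linearr f)). Qed.

Lemma compDm X Y Z (f : mor X Y) (g h : mor Y Z) :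
  (g + h) \oc f = g \oc f + h \oc f.
Proof. exact: (linear_add (compm_linearl f)). Qed.

Lemma compmD X Y Z (f : mor Y Z) (g h : mor X Y) :
  f \oc (g + h) = f \oc g + f \oc h.
Proof. exact: (linear_add (compm_linearr f)). Qed.

Lemma compNm X Y Z (f : mor X Y) (g : mor Y Z) : (- g) \oc f = - (g \oc f).
Proof. exact: (linear_opp (compm_linearl f)). Qed.

Lemma compmN X Y Z (f : mor Y Z) (g : mor X Y) : f \oc (- g) = - (f \oc g).
Proof. exact: (linear_opp (compm_linearr f)). Qed.

(** Composites are kept associated to the left, so an identity must be usable behind an arbitrary
    [e]; this lemma and the next two turn equations into such rewrite rules. *)
Lemma comp_under X Y Z W (a : mor Y Z) (b : mor X Y) (c : mor X Z) :
  a \oc b = c -> forall e : mor Z W, e \oc a \oc b = e \oc c.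
Proof. by move=> <- e; rewrite compmA. Qed.

Lemma comp_under2 X Y Y' Z W (a : mor Y Z) (b : mor X Y) (c : mor Y' Z) (d : mor X Y') :
  a \oc b = c \oc d -> forall e : mor Z W, e \oc a \oc b = e \oc c \oc d.
Proof. by move=> abcd e; rewrite -!compmA abcd. Qed.

Lemma comp_under3 X X' Y Y' Z W (a : mor Y Z) (b : mor X Y) (b' : mor X' X)
    (c : mor Y' Z) (d : mor X' Y') :
  a \oc b \oc b' = c \oc d ->
  forall e : mor Z W, e \oc a \oc b \oc b' = e \oc c \oc d.
Proof. by move=> abcd e; rewrite -!compmA -abcd -!compmA. Qed.

Lemma epi_comp X Y Z (f : mor Y Z) (g : mor X Y) :
  is_epi f -> is_epi g -> is_epi (f \oc g).
Proof. by move=> ef eg W h h'; rewrite !compmA => /eg /ef. Qed.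

Lemma iso_epi X Y (f : mor X Y) : is_iso f -> is_epi f.
Proof.
move=> [g [_ fg]] W h h' /(congr1 (fun u => u \oc g)).
by rewrite -!compmA fg !compm1.
Qed.

Lemma iso_mono X Y (f : mor X Y) : is_iso f -> is_mono f.
Proof.
move=> [g [gf _]] W h h' /(congr1 (fun u => g \oc u)).
by rewrite !compmA gf !comp1m.
Qed.

Lemma mono_comp X Y Z (f : mor Y Z) (g : mor X Y) :
  is_mono f -> is_mono g -> is_mono (f \oc g).
Proof. by move=> mf mg W h h'; rewrite -!compmA => /mf /mg. Qed.

Lemma epi_of_comp0 X Y (f : mor X Y) :
  (forall Z (g : mor Y Z), g \oc f = 0 -> g = 0) -> is_epi f.
Proof.
move=> f0 Z g h gfhf; apply/eqP; rewrite -subr_eq0; apply/eqP/f0.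
by rewrite compDm compNm gfhf subrr.
Qed.

Lemma cokernel_epi X Y Q (p : mor Y Q) (f : mor X Y) : is_cokernel p f -> is_epi p.
Proof.
move=> [pf0 uni] W g h gphp.
have [|k [_ kU]] := uni W (g \oc p); first by rewrite -compmA pf0 compm0.
by rewrite -(kU g) // -(kU h).
Qed.

Lemma kernel_lift N X Y W (i : mor N X) (f : mor X Y) (g : mor W X) :
  is_kernel i f -> f \oc g = 0 -> exists h, i \oc h = g.
Proof. by case=> _ uni /uni [h [ih _]]; exists h. Qed.

Lemma cokernel_desc X Y Q W (p : mor Y Q) (f : mor X Y) (g : mor Y W) :
  is_cokernel p f -> g \oc f = 0 -> exists h, h \oc p = g.
Proof. by case=> _ uni /uni [h [ih _]]; exists h. Qed.

(** Membership of a generalized element in a subobject. *)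
Definition lands_in X (S : subobject X) W (f : mor W X) : Prop :=
  exists h : mor W (sub_dom S), sub_arr S \oc h = f.

Variables (X : C) (S : subobject X).

Lemma lands_in_comp W W' (f : mor W X) (g : mor W' W) :
  lands_in S f -> lands_in S (f \oc g).
Proof. by case=> h <-; exists (h \oc g); rewrite compmA. Qed.

Lemma lands_inD W (f g : mor W X) :
  lands_in S f -> lands_in S g -> lands_in S (f + g).
Proof. by move=> [h <-] [k <-]; exists (h + k); rewrite compmD. Qed.

Lemma lands_inB W (f g : mor W X) :
  lands_in S f -> lands_in S g -> lands_in S (f - g).
Proof. by move=> [h <-] [k <-]; exists (h - k); rewrite compmD compmN. Qed.

End LinearCategory.

(** * Images, epimorphisms and coherence *)

Section TensorCategory.
Variables (K : fieldType) (C : symTensorCat K).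
Implicit Types X Y Z W : C.

Lemma mono_kernel X (S : subobject X) :
  exists Z (z : mor X Z), is_kernel (sub_arr S) z.
Proof. exact: mono_normal (stc_abelian C) _ _ _ (@sub_mono _ _ _ S). Qed.

(** Membership may be tested on an epimorphic cover: [S] is the kernel of some [z], and [z f e = 0]
    forces [z f = 0]. *)
Lemma lands_in_epi X (S : subobject X) W W' (f : mor W X) (e : mor W' W) :
  is_epi e -> lands_in S (f \oc e) -> lands_in S f.
Proof.
move=> ee [h Sh]; have [Z [z kz]] := mono_kernel S.
apply: (kernel_lift kz); apply: ee.
by rewrite -compmA -Sh compmA kz.1 !comp0m.
Qed.

Lemma im_sub_factor X Y (f : mor X Y) :
  exists2 e : mor X (sub_dom (im_sub f)), is_epi e & sub_arr (im_sub f) \oc e = f.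
Proof.
have ki := ker_subP (coker f).
have [e ie] := kernel_lift ki (cokerP f).1.
exists e => //; apply: epi_of_comp0 => W t te0.
have kk := ker_subP t; set k := sub_arr _ in kk.
have [e' ke'] := kernel_lift kk te0.
(* If [t] kills [e], then [f] factors through this smaller subobject [ik]. Being the kernel of some
   [z] with [z f = 0], it contains the whole image, so [k] splits and [t = 0]. *)
pose ik := Subobject (mono_comp (@sub_mono _ _ _ (im_sub f)) (@sub_mono _ _ _ (ker_sub t))).
have [Z [z kz]] := mono_kernel ik.
have zf : z \oc f = 0 by rewrite -ie -ke' !compmA -[_ \oc _ \oc k]compmA kz.1 comp0m.
have [z' z'E] := cokernel_desc (cokerP f) zf.
have zi : z \oc sub_arr (im_sub f) = 0 by rewrite -z'E -compmA ki.1 compm0.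
have [s iks] := kernel_lift kz zi.
have ks : k \oc s = idm _.
  by apply: (@sub_mono _ _ _ (im_sub f)); rewrite compm1 compmA.
by rewrite -[t]compm1 -ks compmA kk.1 comp0m.
Qed.

Lemma im_sub_le X Y (f : mor X Y) (S : subobject Y) :
  lands_in S f -> sub_le (im_sub f) S.
Proof.
have [e ee ie] := im_sub_factor f; rewrite -{1}ie.
exact: lands_in_epi.
Qed.

Lemma epi_short_exact X Y (p : mor X Y) : is_epi p ->
  exists N (i : mor N X), short_exact i p.
Proof.
move=> ep; have [N [i ki]] := has_kernels (stc_abelian C) p.
exists N, i; split=> //; split; first exact: ki.1.
have [Z [g cg]] := epi_normal (stc_abelian C) ep.
move=> W h hi0; have [g' ig'] := kernel_lift ki cg.1.
by apply: cg.2; rewrite -ig' compmA hi0 comp0m.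
Qed.

Lemma tensm_epi X X' Y Y' (f : mor X X') (g : mor Y Y') :
  is_epi f -> is_epi g -> is_epi (f \tm g).
Proof.
move=> ef eg; rewrite -[f]comp1m -[g]compm1 tensmM.
apply: epi_comp.
  by have [N [i /(tensm_exactl X')[_ /cokernel_epi]]] := epi_short_exact eg.
by have [N [i /(tensm_exactr Y)[_ /cokernel_epi]]] := epi_short_exact ef.
Qed.

Lemma tensmD X X' Y Y' (f : mor X X') (g h : mor Y Y') :
  f \tm (g + h) = f \tm g + f \tm h.
Proof. exact: (linear_add (tensm_linearr f)). Qed.

Lemma tensDm X X' Y Y' (g h : mor X X') (f : mor Y Y') :
  (g + h) \tm f = g \tm f + h \tm f.
Proof. exact: (linear_add (tensm_linearl f)). Qed.

Lemma tens0m X X' Y Y' (f : mor Y Y') : (0 : mor X X') \tm f = 0.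
Proof. exact: (linear_zero (tensm_linearl f)). Qed.

Lemma tensm0 X X' Y Y' (f : mor Y Y') : f \tm (0 : mor X X') = 0.
Proof. exact: (linear_zero (tensm_linearr f)). Qed.

Lemma tens_comp1l X Y Y' Y'' (g' : mor Y' Y'') (g : mor Y Y') :
  (idm X \tm g') \oc (idm X \tm g) = idm X \tm (g' \oc g).
Proof. by rewrite -tensmM comp1m. Qed.

Lemma tens_comp1r X Y Y' Y'' (g' : mor Y' Y'') (g : mor Y Y') :
  (g' \tm idm X) \oc (g \tm idm X) = (g' \oc g) \tm idm X.
Proof. by rewrite -tensmM comp1m. Qed.

Lemma tens_compr X X' X'' Y Y' (f : mor X' X'') (g : mor X X') (h : mor Y Y') :
  (f \oc g) \tm h = (f \tm h) \oc (g \tm idm Y).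
Proof. by rewrite -tensmM compm1. Qed.

Lemma tens_compr' X X' X'' Y Y' (f : mor X' X'') (g : mor X X') (h : mor Y Y') :
  h \tm (f \oc g) = (h \tm f) \oc (idm Y \tm g).
Proof. by rewrite -tensmM compm1. Qed.

Definition inv_iso X Y (f : mor X Y) (f_iso : is_iso f) : mor Y X :=
  projT1 (cid f_iso).

Lemma inv_isoK X Y (f : mor X Y) (f_iso : is_iso f) : inv_iso f_iso \oc f = idm X.
Proof. exact: (projT2 (cid f_iso)).1. Qed.

Lemma inv_isoVK X Y (f : mor X Y) (f_iso : is_iso f) : f \oc inv_iso f_iso = idm Y.
Proof. exact: (projT2 (cid f_iso)).2. Qed.

Definition assocV X Y Z := inv_iso (assoc_iso X Y Z).
Definition lunitV X := inv_iso (lunit_iso X).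
Definition runitV X := inv_iso (runit_iso X).

Lemma assocK X Y Z : assocV X Y Z \oc assoc X Y Z = idm _.
Proof. exact: inv_isoK. Qed.
Lemma assocVK X Y Z : assoc X Y Z \oc assocV X Y Z = idm _.
Proof. exact: inv_isoVK. Qed.
Lemma lunitVK X : lunit X \oc lunitV X = idm _.
Proof. exact: inv_isoVK. Qed.
Lemma runitVK X : runit X \oc runitV X = idm _.
Proof. exact: inv_isoVK. Qed.

Lemma assocV_nat X X' Y Y' Z Z' (f : mor X X') (g : mor Y Y') (h : mor Z Z') :
  assocV X' Y' Z' \oc (f \tm (g \tm h)) = ((f \tm g) \tm h) \oc assocV X Y Z.
Proof.
rewrite -[LHS]compm1 -(assocVK X Y Z) compmA -(compmA _ _ (assoc X Y Z)) -assoc_nat.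
by rewrite compmA assocK comp1m.
Qed.

Lemma tens1_inj X Y (f g : mor X Y) : idm tunit \tm f = idm tunit \tm g -> f = g.
Proof.
move=> /(congr1 (compm (lunit Y))); rewrite !lunit_nat.
exact: iso_epi (lunit_iso X) _ _ _.
Qed.

Lemma tens1r_inj X Y (f g : mor X Y) : f \tm idm tunit = g \tm idm tunit -> f = g.
Proof.
move=> /(congr1 (compm (runit Y))); rewrite !runit_nat.
exact: iso_epi (runit_iso X) _ _ _.
Qed.

Lemma tensm_iso X X' Y Y' (f : mor X X') (g : mor Y Y') :
  is_iso f -> is_iso g -> is_iso (f \tm g).
Proof.
move=> [f' [f'f ff']] [g' [g'g gg']]; exists (f' \tm g').
by rewrite -!tensmM f'f g'g ff' gg' !tensm1.
Qed.

Lemma idm_iso X : is_iso (idm X).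
Proof. by exists (idm X); rewrite comp1m. Qed.

Lemma symm_iso X Y : is_iso (symm X Y).
Proof. by exists (symm Y X); rewrite !symmK. Qed.

(* Kelly's argument: the remaining unit coherences follow from the pentagon. *)
Lemma lunit_tens X Y : lunit (X \ox Y) \oc assoc tunit X Y = lunit X \tm idm Y.
Proof.
apply: tens1_inj; apply: (iso_epi (assoc_iso tunit (tunit \ox X) Y)).
apply: (iso_epi (tensm_iso (assoc_iso tunit tunit X) (idm_iso Y))).
rewrite -tens_comp1l -!compmA (compmA (idm _ \tm assoc _ _ _)) -pentagon.
rewrite compmA triangle -tensm1 -assoc_nat -triangle -tens_comp1r.
by rewrite !compmA assoc_nat.
Qed.

Lemma lunit_symm X : lunit X \oc symm X tunit = runit X.
Proof.
apply: tens1r_inj; apply: (iso_mono (symm_iso X tunit)).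
rewrite -tens_comp1r.
have := congr1 (compm (lunit (tunit \ox X))) (hexagon X tunit tunit).
rewrite !compmA lunit_tens -symm_nat lunit_nat.
rewrite (comp_under (triangle _ _)) (comp_under (lunit_tens _ _)).
by move=> ->.
Qed.

Lemma lunit1_runit1 : lunit tunit = runit (tunit : C).
Proof.
apply: tens1r_inj; rewrite -lunit_tens -triangle; congr (_ \oc _).
apply: (iso_mono (lunit_iso tunit)).
by rewrite lunit_nat.
Qed.

(** Moves [X] past [Y] in a product nested to the right; locked so that rewriting treats it as one
    arrow. *)
Definition braid X Y Z : mor (X \ox (Y \ox Z)) (Y \ox (X \ox Z)) :=
  locked (assoc Y X Z \oc (symm X Y \tm idm Z) \oc assocV X Y Z).

Lemma braidE X Y Z :
  braid X Y Z = assoc Y X Z \oc (symm X Y \tm idm Z) \oc assocV X Y Z.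
Proof. by rewrite /braid -lock. Qed.

(** This lemma, [braid_assoc_mid] and [braid_assoc_out] serve coassociativity in [ext_cmulA]: they
    treat [X] landing in the first, second and third tensor factor. *)
Lemma assocV_pentagon X Y Z W :
  assoc (X \ox Y) Z W \oc (assocV X Y Z \tm idm W) \oc assocV X (Y \ox Z) W
  = assocV X Y (Z \ox W) \oc (idm X \tm assoc Y Z W).
Proof.
apply: (iso_mono (assoc_iso X Y (Z \ox W))).
rewrite !compmA pentagon assocVK comp1m.
rewrite (comp_under (tens_comp1r _ _ _)) assocVK tensm1 compm1.
by rewrite -compmA assocVK compm1.
Qed.

Lemma braid_assoc_mid X Y Z W :
  assoc Y (X \ox Z) W \oc (braid X Y Z \tm idm W) \oc assocV X (Y \ox Z) W
  = (idm Y \tm assocV X Z W) \oc braid X Y (Z \ox W) \oc (idm X \tm assoc Y Z W).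
Proof.
apply: (iso_mono (tensm_iso (idm_iso Y) (assoc_iso X Z W))).
rewrite !braidE -!tens_comp1r !compmA tens_comp1l assocVK tensm1 comp1m.
rewrite -pentagon -!compmA -assocV_pentagon !compmA.
by rewrite (comp_under (assoc_nat _ _ _)) tensm1 compmA.
Qed.

Lemma hexagonV X Y Z :
  assoc Y Z X \oc symm X (Y \ox Z)
  = (idm Y \tm symm X Z) \oc assoc Y X Z \oc (symm X Y \tm idm Z) \oc assocV X Y Z.
Proof.
by rewrite -hexagon -compmA assocVK compm1.
Qed.

Lemma braid_assoc_out X Y Z W :
  assoc Y Z (X \ox W) \oc braid X (Y \ox Z) W
  = (idm Y \tm braid X Z W) \oc braid X Y (Z \ox W) \oc (idm X \tm assoc Y Z W).
Proof.
have -> : idm Y \tm braid X Z W = (idm Y \tm assoc Z X W)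
    \oc (idm Y \tm (symm X Z \tm idm W)) \oc (idm Y \tm assocV X Z W).
  by rewrite !tens_comp1l braidE.
rewrite -!compmA (compmA (idm Y \tm assocV _ _ _)).
rewrite -braid_assoc_mid !compmA.
rewrite -(compmA _ (_ \tm (_ \tm _))) -assoc_nat compmA.
rewrite !braidE -!tens_comp1r !compmA pentagon.
by rewrite (comp_under (tens_comp1r _ _ _)) hexagonV -!tens_comp1r !compmA.
Qed.

Lemma symm_assocV X Y Z :
  symm (X \ox Y) Z \oc assocV X Y Z = braid X Z Y \oc (idm X \tm symm Y Z).
Proof.
apply: (iso_mono (symm_iso Z (X \ox Y))); apply: (iso_mono (assoc_iso X Y Z)).
rewrite (compmA (symm _ _)) symmK comp1m assocVK braidE !compmA hexagonV.
rewrite (comp_under (assocK _ _ _)) compm1.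
rewrite (comp_under (tens_comp1r _ _ _)) symmK tensm1 compm1.
rewrite (comp_under (assocVK _ _ _)) compm1.
by rewrite tens_comp1l symmK tensm1.
Qed.

Lemma symm_braid X Y Z :
  symm Z (X \ox Y) \oc braid X Z Y = assocV X Y Z \oc (idm X \tm symm Z Y).
Proof.
rewrite -[braid X Z Y]compm1 -tensm1 -(symmK Z Y) -tens_comp1l.
by rewrite (compmA (braid _ _ _)) -symm_assocV !compmA symmK comp1m.
Qed.

Lemma lunit_braid X Y :
  lunit (X \ox Y) \oc braid X tunit Y = idm X \tm lunit Y.
Proof.
rewrite braidE !compmA lunit_tens tens_comp1r lunit_symm -triangle.
by rewrite -compmA assocVK compm1.
Qed.

Lemma braid_nat X X' Y Y' Z Z' (f : mor X X') (g : mor Y Y') (h : mor Z Z') :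
  braid X' Y' Z' \oc (f \tm (g \tm h)) = (g \tm (f \tm h)) \oc braid X Y Z.
Proof.
rewrite !braidE -!compmA assocV_nat (compmA (symm _ _ \tm _)) -tensmM.
rewrite symm_nat comp1m -[h]compm1 tensmM compm1 !compmA assoc_nat.
by rewrite -!compmA.
Qed.

End TensorCategory.

(** * Cocommutative coalgebras *)

(** A left counit law suffices: cocommutativity yields the right one, [cmulm1]. *)
Record coalg (K : fieldType) (C : symTensorCat K) := Coalg {
  cob :> C;
  cmul : mor cob (cob \ox cob);
  ceps : mor cob tunit;
  cmulA : assoc cob cob cob \oc (cmul \tm idm cob) \oc cmul = (idm cob \tm cmul) \oc cmul;
  cmulC : symm cob cob \oc cmul = cmul;
  cmul1m : lunit cob \oc (ceps \tm idm cob) \oc cmul = idm cob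
}.

Section UnitCoalgebra.
Variables (K : fieldType) (C : symTensorCat K).

Lemma unit_cmulA : assoc tunit tunit tunit \oc (lunitV tunit \tm idm tunit)
    \oc lunitV tunit = (idm tunit \tm lunitV tunit) \oc lunitV (tunit : C).
Proof.
apply: (iso_mono (tensm_iso (idm_iso tunit) (lunit_iso tunit))).
rewrite !compmA triangle -lunit1_runit1 tens_comp1r tens_comp1l.
by rewrite lunitVK !tensm1.
Qed.

Lemma unit_cmulC : symm tunit tunit \oc lunitV tunit = lunitV (tunit : C).
Proof.
apply: (iso_mono (lunit_iso tunit)).
by rewrite compmA lunit_symm -lunit1_runit1.
Qed.

Lemma unit_cmul1m : lunit tunit \oc (idm tunit \tm idm tunit) \oc lunitV tunit
  = idm (tunit : C).
Proof. by rewrite tensm1 compm1 lunitVK. Qed.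

Definition unit_coalg : coalg C := Coalg unit_cmulA unit_cmulC unit_cmul1m.

End UnitCoalgebra.

Section ExtendedCoalgebra.
Variables (K : fieldType) (C : symTensorCat K) (B : coalg C) (X D : C).
Variables (i : mor B D) (j : mor (X \ox B) D) (p : mor D B) (q : mor D (X \ox B)).
Hypothesis Dbip : is_biproduct i j p q.

Let pi : p \oc i = idm B. Proof. by case: Dbip. Qed.
Let qj : q \oc j = idm _. Proof. by case: Dbip. Qed.
Let qi : q \oc i = 0. Proof. by case: Dbip. Qed.
Let pj : p \oc j = 0. Proof. by case: Dbip. Qed.

Lemma biproduct_ext Y (f g : mor D Y) : f \oc i = g \oc i -> f \oc j = g \oc j -> f = g.
Proof.
case: Dbip => _ _ _ _ ipjq fi fj.
by rewrite -[f]compm1 -[g]compm1 -ipjq !compmD !compmA fi fj.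
Qed.

Notation Delta := (cmul B).

(* [D] is the tensor product of [B] with the coalgebra [1 (+) X] in which [X] is
   primitive, so the factor [X] of [X (x) B] goes to either side. *)
Definition ext_cmul : mor D (D \ox D) :=
  (i \tm i) \oc Delta \oc p
  + ((j \tm i) \oc assocV X B B + (i \tm j) \oc braid X B B)
    \oc (idm X \tm Delta) \oc q.

Lemma ext_cmul_i : ext_cmul \oc i = (i \tm i) \oc Delta.
Proof. by rewrite /ext_cmul compDm -!compmA pi qi !compm0 addr0 compm1. Qed.

Lemma ext_cmul_j : ext_cmul \oc j =
  (j \tm i) \oc assocV X B B \oc (idm X \tm Delta)
  + (i \tm j) \oc braid X B B \oc (idm X \tm Delta).
Proof.
rewrite /ext_cmul compDm -[_ \oc p \oc j]compmA pj compm0 add0r.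
by rewrite -[_ \oc q \oc j]compmA qj compm1 compDm.
Qed.

Lemma ext_cmulA : assoc D D D \oc (ext_cmul \tm idm D) \oc ext_cmul
  = (idm D \tm ext_cmul) \oc ext_cmul.
Proof.
have Dassoc : (idm X \tm assoc B B B) \oc (idm X \tm (Delta \tm idm B))
    \oc (idm X \tm Delta) = (idm X \tm (idm B \tm Delta)) \oc (idm X \tm Delta).
  by rewrite !tens_comp1l cmulA.
apply: biproduct_ext.
  rewrite -!compmA ext_cmul_i !compmA -(compmA _ (_ \tm idm D)) -!tensmM comp1m.
  rewrite ext_cmul_i tens_compr tens_compr' !compmA assoc_nat.
  by rewrite -!compmA !(compmA (assoc _ _ _)) cmulA.
rewrite -!compmA ext_cmul_j !compmD !compmA.
rewrite !(comp_under (esym (tensmM _ _ _ _))) -!tensmM !comp1m ext_cmul_i ext_cmul_j.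
rewrite tensDm tensmD compmD !compDm -addrA; congr (_ + (_ + _)).
- rewrite !tens_compr tens_compr' !compmA assoc_nat.
  rewrite (comp_under2 (esym (assocV_nat _ _ _))) (comp_under3 (assocV_pentagon _ _ _ _)).
  rewrite (comp_under3 Dassoc) -[idm (X \ox B)]tensm1.
  by rewrite (comp_under2 (esym (assocV_nat _ _ _))).
- rewrite !tens_compr !tens_compr' !compmA assoc_nat.
  rewrite (comp_under2 (esym (assocV_nat _ _ _))) (comp_under3 (braid_assoc_mid _ _ _ _)).
  rewrite (comp_under2 (esym (braid_nat _ _ _))) !compmA.
  by rewrite (comp_under3 Dassoc).
- rewrite !tens_compr !tens_compr' !compmA assoc_nat.
  rewrite -[idm (X \ox B)]tensm1 !(comp_under2 (esym (braid_nat _ _ _))).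
  rewrite (comp_under (braid_assoc_out _ _ _ _)) !compmA.
  by rewrite (comp_under3 Dassoc).
Qed.

Lemma ext_cmulC : symm D D \oc ext_cmul = ext_cmul.
Proof.
apply: biproduct_ext; rewrite -compmA ?ext_cmul_i ?ext_cmul_j.
  by rewrite compmA symm_nat -compmA cmulC.
(* The symmetry exchanges the two summands that send [X] left and right. *)
rewrite compmD !compmA !symm_nat addrC; congr (_ + _).
  by rewrite (comp_under (symm_braid _ _ _)) !compmA (comp_under (tens_comp1l _ _ _)) cmulC.
by rewrite (comp_under (symm_assocV _ _ _)) !compmA (comp_under (tens_comp1l _ _ _)) cmulC.
Qed.

Definition ext_ceps : mor D tunit := ceps B \oc p.

Lemma ext_ceps_i : ext_ceps \oc i = ceps B.
Proof. by rewrite /ext_ceps -compmA pi compm1. Qed.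

Lemma ext_ceps_j : ext_ceps \oc j = 0.
Proof. by rewrite /ext_ceps -compmA pj compm0. Qed.

Lemma ext_cmul1m : lunit D \oc (ext_ceps \tm idm D) \oc ext_cmul = idm D.
Proof.
apply: biproduct_ext; rewrite -compmA ?ext_cmul_i ?ext_cmul_j comp1m.
  rewrite !compmA (comp_under (esym (tensmM _ _ _ _))) ext_ceps_i comp1m.
  rewrite -[ceps B]comp1m -[i in _ \tm i]compm1 tensmM !compmA lunit_nat.
  by rewrite -!compmA (compmA (lunit _)) cmul1m compm1.
rewrite compmD !compmA !(comp_under (esym (tensmM _ _ _ _))) ext_ceps_i ext_ceps_j.
rewrite tens0m !(compm0, comp0m) add0r comp1m.
rewrite -[ceps B]comp1m -[j in _ \tm j]compm1 tensmM !compmA lunit_nat.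
rewrite -[idm (X \ox B)]tensm1 (comp_under2 (esym (braid_nat _ _ _))).
rewrite (comp_under (lunit_braid _ _)) !(comp_under (tens_comp1l _ _ _)).
by rewrite compmA cmul1m tensm1 compm1.
Qed.

Definition ext_coalg : coalg C := Coalg ext_cmulA ext_cmulC ext_cmul1m.

End ExtendedCoalgebra.

(** * Convolution rings *)

Section Convolution.
Variables (K : fieldType) (C : symTensorCat K) (A : algebraIn C) (B : coalg C).

Definition conv : Type := mor (cob B) (carrier A).
HB.instance Definition _ := GRing.Zmodule.on conv.

Definition conv_mul (f g : conv) : conv := amul A \oc (f \tm g) \oc cmul B.
Definition conv_one : conv := aunit A \oc ceps B.

Lemma conv_mulA : associative conv_mul.
Proof.
move=> f g h; rewrite /conv_mul.
have -> : f \tm (amul A \oc (g \tm h) \oc cmul B) =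
    (idm A \tm amul A) \oc (f \tm (g \tm h)) \oc (idm B \tm cmul B).
  by rewrite -!tensmM !comp1m !compm1 ?compmA.
have -> : (amul A \oc (f \tm g) \oc cmul B) \tm h =
    (amul A \tm idm A) \oc ((f \tm g) \tm h) \oc (cmul B \tm idm B).
  by rewrite -!tensmM !comp1m !compm1 ?compmA.
rewrite !compmA amulA -!compmA -cmulA !compmA.
by rewrite (comp_under (assoc_nat _ _ _)) !compmA.
Qed.

Lemma cmulm1 : runit B \oc (idm B \tm ceps B) \oc cmul B = idm B.
Proof.
by rewrite -lunit_symm -(compmA _ (symm _ _)) symm_nat -!compmA cmulC compmA cmul1m.
Qed.

Lemma conv_mul1 : left_id conv_one conv_mul.
Proof.
move=> f; rewrite /conv_mul /conv_one.
have -> : (aunit A \oc ceps B) \tm f =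
    (aunit A \tm idm A) \oc (idm tunit \tm f) \oc (ceps B \tm idm B).
  by rewrite -!tensmM !comp1m !compm1 ?compmA.
by rewrite !compmA amul1m lunit_nat -!compmA (compmA (lunit _)) cmul1m compm1.
Qed.

Lemma conv_mulr1 : right_id conv_one conv_mul.
Proof.
move=> f; rewrite /conv_mul /conv_one.
have -> : f \tm (aunit A \oc ceps B) =
    (idm A \tm aunit A) \oc (f \tm idm tunit) \oc (idm B \tm ceps B).
  by rewrite -!tensmM !comp1m !compm1 ?compmA.
by rewrite !compmA amulm1 runit_nat -!compmA (compmA (runit _)) cmulm1 compm1.
Qed.

Lemma conv_mulDl : left_distributive conv_mul +%R.
Proof. by move=> f g h; rewrite /conv_mul tensDm compmD compDm. Qed.

Lemma conv_mulDr : right_distributive conv_mul +%R.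
Proof. by move=> f g h; rewrite /conv_mul tensmD compmD compDm. Qed.

HB.instance Definition _ := GRing.Zmodule_isPzRing.Build conv
  conv_mulA conv_mul1 conv_mulr1 conv_mulDl conv_mulDr.

Lemma conv_inv6 : [pchar K] =i pred0 -> exists t : conv, t *+ 6 = 1.
Proof.
move=> /pcharf0P charK; exists ((6%:R^-1 : K) *: conv_one : mor (cob B) (carrier A)).
suff six (V : lmodType K) (v : V) : (6%:R^-1 *: v) *+ 6 = v by exact: six.
by rewrite scalerMnl -mulr_natr mulVf ?scale1r // charK.
Qed.

Lemma conv_mulE (f g : conv) : f * g = amul A \oc (f \tm g) \oc cmul B.
Proof. by []. Qed.

(** Cocommutativity of [B] turns the exchange of [f] and [g] into the symmetry of [A], so ring
    commutators are induced by the categorical [commutator]. *)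
Lemma conv_mul_swap (f g : conv) :
  g * f = amul A \oc symm A A \oc (f \tm g) \oc cmul B.
Proof. by rewrite conv_mulE -(compmA _ (symm _ _)) symm_nat -!compmA cmulC. Qed.

Lemma conv_brk (f g : conv) :
  brk f g = commutator A \oc (f \tm g) \oc cmul B.
Proof.
rewrite /brk (conv_mul_swap f g) conv_mulE /commutator compmD compmN compm1.
by rewrite !compDm !compNm.
Qed.

Definition lands_lcs n (f : conv) := lands_in (lcs A n) f.
Definition lands_ideal n (f : conv) := lands_in (lcs_ideal A n) f.

Lemma lands_lcs_brk n (g f : conv) : lands_lcs n f -> lands_lcs n.+1 (brk g f).
Proof.
(* For [n = 0] the target is [lcs A 1], the whole of [A]. *)
case: n => [|n] [h <-]; first by exists (brk g (sub_arr (lcs A 0) \oc h)); rewrite comp1m.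
have [e _ ie] := im_sub_factor (commutator A \oc (idm A \tm sub_arr (lcs A n.+1))).
exists (e \oc (g \tm h) \oc cmul B).
rewrite conv_brk !compmA [sub_arr _ \oc e]ie.
by rewrite (comp_under (esym (tensmM _ _ _ _))) comp1m.
Qed.

Lemma lc_lands_lcs n (f : conv) : lc n f -> lands_lcs n f.
Proof.
elim=> [g | k r g _ | k g h _ Lg _ Lh].
- by exists g; rewrite comp1m.
- exact: lands_lcs_brk.
- exact: lands_inD.
Qed.

Lemma lands_ideal_mul_lcs n (g f : conv) : lands_lcs n f -> lands_ideal n (g * f).
Proof.
case=> h <-.
have [e _ ie] := im_sub_factor (amul A \oc (idm A \tm sub_arr (lcs A n))).
exists (e \oc (g \tm h) \oc cmul B).
rewrite conv_mulE !compmA [sub_arr _ \oc e]ie.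
by rewrite (comp_under (esym (tensmM _ _ _ _))) comp1m.
Qed.

Lemma lcs_lands_ideal n (f : conv) : lands_lcs n f -> lands_ideal n f.
Proof. by rewrite -[f in lands_ideal _ f]mul1r; exact: lands_ideal_mul_lcs. Qed.

End Convolution.

(** * Adjoining letters and transferring ring identities to subobjects *)

Section Letters.
Variables (K : fieldType) (C : symTensorCat K) (A : algebraIn C).

(* [x] is a new variable adjoined to the convolution algebra of [B], ranging over
   the generalized element [mu]; precomposition with [p] embeds the old algebra,
   and [j] picks out the part of an element that is linear in [x]. *)
Record letter (B : coalg C) (X : C) (mu : mor X A) (D : coalg C) (p : mor D B)
    (j : mor (X \ox B) D) (x : conv A D) : Prop := Letter {
  letterM : forall f g : conv A B,
    ((f * g : conv A B) \oc p : conv A D) = (f \oc p : conv A D) * (g \oc p);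
  letter_mul : forall f : conv A B, (x * (f \oc p)) \oc j = amul A \oc (mu \tm f);
  letter_mulr : forall f : conv A B,
    ((f \oc p : conv A D) * x) \oc j = amul A \oc symm A A \oc (mu \tm f);
  letter_factor : exists h, x = mu \oc h
}.

Lemma letter_exists (B : coalg C) (X : C) (mu : mor X A) :
  exists D p j x, @letter B X mu D p j x.
Proof.
have [D [i [j [p [q Dbip]]]]] := has_biproducts (stc_abelian C) B (X \ox B).
case: (Dbip) => pi qj qi pj _.
(* The letter vanishes on [B] and is [mu] on [X (x) B], with [B] collapsed by the counit. *)
have [x [xi xj xf]] : exists x : mor D A, [/\ x \oc i = 0,
    x \oc j = mu \oc runit X \oc (idm X \tm ceps B) & exists h, x = mu \oc h].
  exists (mu \oc runit X \oc (idm X \tm ceps B) \oc q); split.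
  - by rewrite -compmA qi compm0.
  - by rewrite -compmA qj compm1.
  - by exists (runit X \oc (idm X \tm ceps B) \oc q); rewrite !compmA.
(* Only the summand of the comultiplication with [X] on the left survives, because [x] vanishes on
   [B]. *)
have xfD (f : mor B A) : (x \tm (f \oc p)) \oc ext_cmul i j p q \oc j = mu \tm f.
  rewrite -compmA (ext_cmul_j Dbip) compmD !compmA -!tensmM -!compmA pi pj xi !compm0.
  rewrite tens0m !comp0m addr0 xj compm1 !compmA.
  have -> : (mu \oc runit X \oc (idm X \tm ceps B)) \tm f =
      (mu \tm f) \oc (runit X \tm idm B) \oc ((idm X \tm ceps B) \tm idm B).
    by rewrite -!tensmM !compm1.
  rewrite (comp_under2 (esym (assocV_nat _ _ _))) -triangle !compmA.
  rewrite (comp_under (assocVK _ _ _)) compm1 !(comp_under (tens_comp1l _ _ _)).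
  by rewrite compmA cmul1m tensm1 compm1.
exists (ext_coalg Dbip), p, j, x; split.
- move=> f g; rewrite !conv_mulE /= -!compmA tensmM.
  apply: (biproduct_ext Dbip); rewrite -!compmA.
    by rewrite (ext_cmul_i Dbip) pi (compmA (p \tm p)) -tensmM pi tensm1 comp1m compm1.
  rewrite (ext_cmul_j Dbip) pj !compmD !compmA !(comp_under (esym (tensmM _ _ _ _))).
  by rewrite pj !compm0 tens0m tensm0 !(compm0, comp0m) addr0.
- by move=> f; rewrite conv_mulE /= -!compmA; congr (_ \oc _); rewrite compmA xfD.
- move=> f; rewrite conv_mul_swap /= -!compmA; congr (_ \oc (_ \oc _)).
  by rewrite compmA xfD.
- exact: xf.
Qed.


Lemma letter_brk (B : coalg C) (X : C) (mu : mor X A) (D : coalg C) p j x (f : conv A B) :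
  @letter B X mu D p j x ->
  brk x (f \oc p) \oc j = commutator A \oc (mu \tm f).
Proof.
case=> _ xf fx _; rewrite /brk compDm compNm xf fx /commutator.
by rewrite compmD compmN compm1 compDm compNm.
Qed.

Lemma letter_lc (B : coalg C) (X : C) (mu : mor X A) (D : coalg C) p j x n (f : conv A B) :
  @letter B X mu D p j x -> lc n f -> lc n (f \oc p : conv A D).
Proof.
case=> pM _ _ _; elim=> [g | k r g _ Lg | k g h _ Lg _ Lh]; first exact: lc_one.
- by rewrite /brk compDm compNm !pM; exact: lc_brk.
- by rewrite compDm; exact: lc_add.
Qed.

Definition lc_generated n Y (g : mor Y A) : Prop :=
  exists (B : coalg C) (t : mor Y B) (f : conv A B), lc n f /\ f \oc t = g.

(** After an epimorphic cover the inclusion of [L_(n+1)] becomes the multilinear part of an iterated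
    commutator of letters, one new letter over [idm A] per step. This lets statements about [lc]
    reach the subobject. *)
Lemma lcs_generated n : exists Y (e : mor Y (sub_dom (lcs A n.+1))),
  is_epi e /\ lc_generated n.+1 (sub_arr (lcs A n.+1) \oc e).
Proof.
elim: n => [|n [Y [e [ee [B [t [f [lf ft]]]]]]]].
  have [D [p [j [x [_ xf _ _]]]]] := letter_exists (unit_coalg C) (idm A).
  exists A, (idm A); split; first exact: iso_epi (idm_iso _).
  exists D, (j \oc runitV A), (x * (aunit A \oc p)); split; first exact: lc_one.
  by rewrite compmA xf amulm1 runitVK compm1.
have [D [p [j [x Lx]]]] := letter_exists B (idm A).
have [q eq iq] := im_sub_factor (commutator A \oc (idm A \tm sub_arr (lcs A n.+1))).
exists (A \ox Y), (q \oc (idm A \tm e)); split.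
  by apply: epi_comp => //; apply: tensm_epi => //; exact: iso_epi (idm_iso _).
exists D, (j \oc (idm A \tm t)), (brk x (f \oc p)); split.
  by apply: lc_brk; exact: letter_lc Lx lf.
rewrite !compmA (letter_brk _ Lx) [sub_arr _ \oc q]iq.
by rewrite -!compmA !tens_comp1l ft.
Qed.

Lemma ideal_generated n : exists Y (e : mor Y (sub_dom (lcs_ideal A n.+1)))
    (B : coalg C) (t : mor Y B) (a f : conv A B),
  [/\ is_epi e, lc n.+1 f & (a * f) \oc t = sub_arr (lcs_ideal A n.+1) \oc e].
Proof.
have [Y [e [ee [B [t [f [lf ft]]]]]]] := lcs_generated n.
have [D [p [j [x Lx]]]] := letter_exists B (idm A).
have [q eq iq] := im_sub_factor (amul A \oc (idm A \tm sub_arr (lcs A n.+1))).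
exists (A \ox Y), (q \oc (idm A \tm e)), D, (j \oc (idm A \tm t)), x, (f \oc p); split.
- by apply: epi_comp => //; apply: tensm_epi => //; exact: iso_epi (idm_iso _).
- exact: letter_lc Lx lf.
- rewrite !compmA (letter_mul Lx) [sub_arr _ \oc q]iq.
  by rewrite -!compmA !tens_comp1l ft.
Qed.

Lemma lcs_ideal_succ n : exists m, lcs_ideal A n = lcs_ideal A m.+1.
Proof. by case: n => [|n]; [exists 0 | exists n]. Qed.

(** It suffices to treat the universal arrow on [A (x) M_n], that is, a letter [x] in place of [r]
    and the generic [a * g] in place of [f]; there associativity suffices. The next two lemmas use
    the same reduction. *)
Lemma lands_ideal_mull n (B : coalg C) (r f : conv A B) :
  lands_ideal n f -> lands_ideal n (r * f).
Proof.
rewrite /lands_ideal; have [m ->] := lcs_ideal_succ n; move: m => {}n.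
case=> h <-.
have [Y [e [D [t [a [g [ee lg agt]]]]]]] := ideal_generated n.
have [D' [p [j [x Lx]]]] := letter_exists D (idm A).
suff L : lands_in (lcs_ideal A n.+1) (amul A \oc (idm A \tm sub_arr (lcs_ideal A n.+1))).
  have := lands_in_comp ((r \tm h) \oc cmul B) L.
  by rewrite conv_mulE !compmA (comp_under (esym (tensmM _ _ _ _))) comp1m.
have e1 : is_epi (idm A \tm e) by apply: tensm_epi => //; exact: iso_epi (idm_iso _).
apply: (lands_in_epi e1).
rewrite -compmA tens_comp1l -agt -tens_comp1l compmA -(letter_mul Lx).
do 2!apply: lands_in_comp; rewrite (letterM Lx) mulrA.
by apply: lands_ideal_mul_lcs; apply: lc_lands_lcs; exact: letter_lc Lx lg.
Qed.

Lemma lands_ideal_mulr n (B : coalg C) (r f : conv A B) :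
  lands_ideal n f -> lands_ideal n (f * r).
Proof.
rewrite /lands_ideal; have [m ->] := lcs_ideal_succ n; move: m => {}n.
case=> h <-.
have [Y [e [D [t [a [g [ee lg agt]]]]]]] := ideal_generated n.
have [D' [p [j [x Lx]]]] := letter_exists D (idm A).
suff L : lands_in (lcs_ideal A n.+1)
    (amul A \oc symm A A \oc (idm A \tm sub_arr (lcs_ideal A n.+1))).
  have := lands_in_comp ((r \tm h) \oc cmul B) L.
  by rewrite conv_mul_swap !compmA (comp_under (esym (tensmM _ _ _ _))) comp1m.
have e1 : is_epi (idm A \tm e) by apply: tensm_epi => //; exact: iso_epi (idm_iso _).
apply: (lands_in_epi e1).
rewrite -compmA tens_comp1l -agt -tens_comp1l compmA -(letter_mulr Lx).
do 2!apply: lands_in_comp; rewrite (letterM Lx).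
set b := (a \oc p : conv A D'); have : lc n.+1 (g \oc p : conv A D') by exact: letter_lc Lx lg.
set l := (g \oc p : conv A D') => ll.
(* Commuting [x] past [l] costs [[x, l]] in [L_(n+1)], which is inside [L_n]; so the left ideal
   [A L_n] is two-sided. *)
have -> : b * l * x = b * x * l - b * brk x l.
  by rewrite /brk mulrBr !mulrA opprB addrC addrNK.
apply: lands_inB; apply: lands_ideal_mul_lcs; apply: lc_lands_lcs => //.
by apply: lcW => //; exact: lc_brk.
Qed.

Hypothesis charK : [pchar K]%R =i pred0.

Lemma lands_ideal_brk n (B : coalg C) (r f : conv A B) : odd n ->
  lands_ideal n f -> lands_lcs n.+1 (brk r f).
Proof.
case: n => // n on [h <-].
have [Y [e [D [t [a [g [ee lg agt]]]]]]] := ideal_generated n.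
have [D' [p [j [x Lx]]]] := letter_exists D (idm A).
suff L : lands_in (lcs A n.+2) (commutator A \oc (idm A \tm sub_arr (lcs_ideal A n.+1))).
  have := lands_in_comp ((r \tm h) \oc cmul B) L.
  by rewrite conv_brk !compmA (comp_under (esym (tensmM _ _ _ _))) comp1m.
have e1 : is_epi (idm A \tm e) by apply: tensm_epi => //; exact: iso_epi (idm_iso _).
apply: (lands_in_epi e1).
rewrite -compmA tens_comp1l -agt -tens_comp1l compmA -(letter_brk _ Lx).
do 2!apply: lands_in_comp; rewrite (letterM Lx).
have [inv6 inv6P] := conv_inv6 A D' charK.
apply: lc_lands_lcs; rewrite -[n.+2]add1n.
(* The ring theorem with [p = 1]: the factor [a] is arbitrary, and [g] lies in a term of odd
   index. *)
apply: (lc_center_odd_odd inv6P) => //; first exact: lc_one.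
exact: letter_lc Lx lg.
Qed.

(** * Products with an ideal of odd index *)

Section OddIdeal.
Variables (j k : nat).
Hypothesis oj : odd j.

Lemma lands_ideal_mul_lc (B : coalg C) (f g : conv A B) :
  lc k g -> lands_ideal j f -> lands_ideal (j + k - 1) (f * g).
Proof.
apply: (@mul_M_lc _ (@lands_lcs _ _ A B) (@lands_ideal _ _ A B)).
- by move=> *; exact: lands_inB.
- by move=> *; exact: lands_inD.
- by move=> *; exact: lands_lcs_brk.
- by move=> *; exact: lcs_lands_ideal.
- by move=> *; exact: lands_inB.
- by move=> *; exact: lands_inD.
- by move=> *; exact: lands_ideal_mulr.
- by move=> *; exact: lands_ideal_brk.
Qed.

Lemma lands_ideal_lc_mul (B : coalg C) (f g : conv A B) :
  lc k g -> lands_ideal j f -> lands_ideal (j + k - 1) (g * f).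
Proof.
apply: (@mul_lc_M _ (@lands_lcs _ _ A B) (@lands_ideal _ _ A B)).
- by move=> *; exact: lands_inB.
- by move=> *; exact: lands_inD.
- by move=> *; exact: lands_lcs_brk.
- by move=> *; exact: lcs_lands_ideal.
- by move=> *; exact: lands_inB.
- by move=> *; exact: lands_inD.
- by move=> *; exact: lands_ideal_mull.
- by move=> *; exact: lands_ideal_brk.
Qed.

Hypothesis k0 : (0 < k)%N.

Let e1 Y (e : mor Y (sub_dom (lcs_ideal A k))) : is_epi e ->
  is_epi (idm (sub_dom (lcs_ideal A j)) \tm e).
Proof. by move=> ee; apply: tensm_epi => //; exact: iso_epi (idm_iso _). Qed.

Lemma odd_ideal_mul_le :
  sub_le (sub_mul (lcs_ideal A j) (lcs_ideal A k)) (lcs_ideal A (j + k - 1)).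
Proof.
apply: im_sub_le.
have [Y [e [B [t [a [g [ee lg agt]]]]]]] := ideal_generated k.-1.
rewrite prednK // in e ee lg agt.
(* The letter ranges over [M_j] itself. The product becomes [(x a) g] with [x a] in [M_j] and [g] in
   [L_k]. *)
have [D [p [i [x Lx]]]] := letter_exists B (sub_arr (lcs_ideal A j)).
apply: (lands_in_epi (e1 ee)).
rewrite -compmA -tensmM compm1 -agt tens_compr' compmA -(letter_mul Lx).
do 2!apply: lands_in_comp; rewrite (letterM Lx) mulrA.
apply: lands_ideal_mul_lc; first exact: letter_lc Lx lg.
apply: lands_ideal_mulr; have [h ->] := letter_factor Lx.
by exists h.
Qed.

Lemma ideal_mul_odd_le :
  sub_le (sub_mul (lcs_ideal A k) (lcs_ideal A j)) (lcs_ideal A (j + k - 1)).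
Proof.
(* Precomposing with the symmetry puts [M_j] first, where the letter sits; the product is then
   [a (g x)]. *)
apply: im_sub_le; apply: (lands_in_epi (iso_epi (symm_iso _ _))).
rewrite -compmA -symm_nat compmA.
have [Y [e [B [t [a [g [ee lg agt]]]]]]] := ideal_generated k.-1.
rewrite prednK // in e ee lg agt.
have [D [p [i [x Lx]]]] := letter_exists B (sub_arr (lcs_ideal A j)).
apply: (lands_in_epi (e1 ee)).
rewrite -compmA -tensmM compm1 -agt tens_compr' compmA -(letter_mulr Lx).
do 2!apply: lands_in_comp; rewrite (letterM Lx) -mulrA.
apply: lands_ideal_mull; apply: lands_ideal_lc_mul; first exact: letter_lc Lx lg.
by have [h ->] := letter_factor Lx; exists h.
Qed.

End OddIdeal.

End Letters.

Local Close Scope cat_scope.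
Local Close Scope ring_scope.

Theorem corollary1p4 (K : fieldType) (charK : [pchar K]%R =i pred0)
    (C : symTensorCat K) (A : algebraIn C) (j k : nat)
    (hj : 1 <= j) (hk : 1 <= k) (hodd : odd j || odd k) :
  sub_le (sub_mul (lcs_ideal A j) (lcs_ideal A k)) (lcs_ideal A (j + k - 1)).
Proof.
have [oj | ok] := orP hodd; first exact: (odd_ideal_mul_le A charK).
by rewrite addnC; exact: (ideal_mul_odd_le A charK).
Qed.
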